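(* Let $L$ be an $m\times k$ weakly norming linear system over $\mathbb{F}_q$ and let $\ell$ be the girth of $L$. Then either all vectors in $\mu(L)$ are Schatten or $s(L)\geq k/\ell$.
   Context: $q$ is a prime power. An $m\times k$ linear system is a matrix $L\in\mathbb{F}_q^{m\times k}$ with linearly independent rows; for $G=\mathbb{F}_q^n$, $\mathrm{Sol}(L)=\{x\in G^k:\sum_j L_{ij}x_j=0\ \forall i\}$ and $t_L(f)=\frac{1}{|\mathrm{Sol}(L)|}\sum_{x\in\mathrm{Sol}(L)}\prod_j f(x_j)$. $L$ is weakly norming if for every $n\ge1$ the functional $f\mapsto t_L(|f|)^{1/k}$ is a norm on real-valued functions on $\mathbb{F}_q^n$. The girth of $L$ is the minimum size of the support of a non-zero vector in the row space of $L$; $\mu(L)$ is the set of non-zero vectors of the row space of $L$ with support of this minimum size. A vector $(a_1,\dots,a_k)\in\mathbb{F}_q^k$ is Schatten if there is $a\in\mathbb{F}_q$ with each $a_i\in\{0,a,-a\}$ and $|\{i:a_i=a\}|=|\{i:a_i=-a\}|$. $s(L)$ is the number of normalised Schatten vectors in $\mu(L)$, i.e. Schatten vectors in $\mu(L)$ whose first non-zero coordinate equals $1$. *)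

(* Defs.v *)
From mathcomp Require Import all_boot all_order all_algebra.
From mathcomp Require Import reals exp.

Set Implicit Arguments.
Unset Strict Implicit.
Unset Printing Implicit Defensive.

Import Order.TTheory GRing.Theory Num.Theory.
Local Open Scope ring_scope.

Section LinearSystem.
Variables (F : finFieldType) (m k : nat) (L : 'M[F]_(m, k)).

Definition sol (n : nat) : {set {ffun 'I_k -> 'rV[F]_n}} :=
  [set x : {ffun 'I_k -> 'rV[F]_n}
    | [forall i : 'I_m, \sum_(j < k) L i j *: x j == 0]].

Definition supp (v : 'rV[F]_k) : {set 'I_k} := [set j | v 0 j != 0].

(* The default value k only matters when the row space is zero (m = 0),
   because a support has at most k elements. *)
Definition girth : nat :=
  \big[minn/k]_(v : 'rV[F]_k | (v <= L)%MS && (v != 0)) #|supp v|.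

Definition mu : {set 'rV[F]_k} :=
  [set v : 'rV[F]_k | [&& (v <= L)%MS, v != 0 & #|supp v| == girth]].

(* In characteristic 2, a = - a and the cardinality condition is vacuous. *)
Definition schatten (v : 'rV[F]_k) : bool :=
  [exists a : F,
     [forall i, v 0 i \in [:: 0; a; - a]] &&
     (#|[set i | v 0 i == a]| == #|[set i | v 0 i == - a]|)].

Definition normalised (v : 'rV[F]_k) : bool :=
  [exists i : 'I_k,
     (v 0 i == 1) && [forall j : 'I_k, (j < i)%N ==> (v 0 j == 0)]].

Definition s : nat := #|[set v in mu | schatten v && normalised v]|.

End LinearSystem.

Definition t (R : realType) (F : finFieldType) (m k : nat) (L : 'M[F]_(m, k))
    (n : nat) (f : 'rV[F]_n -> R) : R :=
  (#|sol L n|%:R)^-1 * \sum_(x in sol L n) \prod_(j < k) f (x j).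

Definition is_norm (R : realType) (T : Type) (N : (T -> R) -> R) : Prop :=
  [/\ forall f, 0 <= N f,
      forall f, N f = 0 -> forall x, f x = 0,
      forall (a : R) f, N (fun x => a * f x) = `|a| * N f
    & forall f g, N (fun x => f x + g x) <= N f + N g].

Definition weakly_norming (R : realType) (F : finFieldType) (m k : nat)
    (L : 'M[F]_(m, k)) : Prop :=
  forall n : nat, (0 < n)%N ->
    is_norm (fun f : 'rV[F]_n -> R =>
      powR (t L (fun x => `|f x|)) (k%:R^-1)).

(* Main.v *)
Require Import Defs.
From mathcomp Require Import all_boot all_order all_algebra all_field.
From mathcomp Require Import reals exp.
From mathcomp Require Import ring lra complex.

(** Weak norming and the tensor power trick give Hölder's inequality for the
    multilinear form [mlin] of [L].  Take real functions [g] on [F] that are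
    combinations of non-trivial additive characters.  Then [t(1 + c g)] is
    [1 + c^l G(g) + O(c^(l+1))], where [l] is the girth, [G(g)] is a sum over
    the supports [S] of vectors of [mu L], and the term of [S] is a sum over
    these vectors.  Hölder's inequality yields [G(g) >= 0] and, to first order,
    [l G(g) <= k G_a(g)] where [G_a] only keeps the supports containing [a].

    For [g = z e + (z e)^*] with [e] a character, only vectors with entries in
    [{0, 1, -1}] contribute, and averaging over the roots of unity [z] only
    leaves the Schatten ones.  If no Schatten vector of [mu L] had [a] in its
    support, the average of [G_a], hence of [G], would vanish, so
    [G(e + e^* ) = 0].  By the triangle inequality the average of
    [e + e^*] over the dilations of [F] would have [G <= 0]; but its
    character coefficients are positive, so [G > 0].  Hence Schatten vectors of
    [mu L] cover all [k] coordinates, with [l] coordinates each. *)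

Set Implicit Arguments.
Unset Strict Implicit.
Unset Printing Implicit Defensive.

Import Order.TTheory GRing.Theory Num.Theory.
Local Open Scope ring_scope.

(** * Polynomials and the multilinear form *)

(** Near [0] from the right the lowest-order term decides the sign. The induction divides by ['X]
    until [d = 0]; this turns inequalities valid for small [c] into inequalities between leading
    coefficients. *)
Lemma coef_ge0_of_horner_ge0 (R : realFieldType) (p : {poly R}) (d : nat)
    (r : R) :
    0 < r -> (forall i, (i < d)%N -> p`_i = 0) ->
    (forall x, 0 < x < r -> 0 <= p.[x]) ->
  0 <= p`_d.
Proof.
move=> r0; elim: d p => [|d IH] p; elim/poly_ind: p => [|q c _].
- by rewrite coef0.
- move=> _ H; rewrite coefD coefMX coefC /= add0r leNgt; apply/negP => c0.
  have [M HM] := poly_disk_bound q 1.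
  have M0 : 0 <= M by apply: le_trans (HM 0 _); rewrite ?normr0.
  (* The three bounds keep [x] below [r], inside the unit disk where [q] is bounded by [M], and so
     small that [q.[x] * x + c < 0]. *)
  pose x := Num.min (r / 2) (Num.min 1 (- c / (2 * (M + 1)))).
  have x0 : 0 < x by rewrite !lt_min; apply/and3P; split; [lra|lra|apply: divr_gt0; lra].
  have xr : x < r by rewrite gt_min; apply/orP; left; lra.
  have x1 : x <= 1 by rewrite !ge_min lexx !orbT.
  have xc : x * (M + 1) <= - c / 2.
    rewrite -ler_pdivlMr; last by lra.
    by rewrite -mulrA -invfM !ge_min lexx !orbT.
  have := H x; rewrite x0 xr hornerMXaddC => /(_ isT).
  have := HM x; rewrite gtr0_norm // => /(_ x1); rewrite ler_norml => /andP[_ h].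
  have : q.[x] * x <= M * x by rewrite ler_wpM2r // ltW.
  nra.
- by rewrite coef0.
- move=> H0 H.
  have c0 : c = 0 by have := H0 0%N isT; rewrite coefD coefMX coefC /= add0r.
  rewrite c0 addr0 coefMX /=; apply: IH => [i id|x xr].
    by have := H0 i.+1 id; rewrite c0 addr0 coefMX.
  have := H x xr; rewrite c0 addr0 hornerMX pmulr_lge0 //.
  by case/andP: xr.
Qed.

(** If [r > 1], Bernoulli's inequality makes the powers [r ^+ (2 ^ N)] unbounded. Exponents [2 ^ N]
    are those produced by repeated doubling of the dimension. *)
Lemma le1_of_bounded_powers (R : realType) (r B : R) :
  0 <= r -> (forall N, r ^+ (2 ^ N) <= B) -> r <= 1.
Proof.
move=> r0 H; rewrite leNgt; apply/negP => r1.
have bern n : 1 + n%:R * (r - 1) <= r ^+ n.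
  elim: n => [|n IH]; first by rewrite mul0r addr0 expr0.
  rewrite exprS -natr1; have n0 : 0 <= n%:R :> R by [].
  have : r * (1 + n%:R * (r - 1)) <= r * r ^+ n by rewrite ler_wpM2l.
  have := mulr_ge0 n0 (sqr_ge0 (r - 1)).
  set y := r * r ^+ n; lra.
have := archi_boundP (normr_ge0 (B / (r - 1))).
set n := Num.bound _ => hn.
have := H n; apply/negP; rewrite -ltNge.
apply: lt_le_trans (bern _).
have h2 : n%:R <= (2 ^ n)%:R :> R by rewrite ler_nat ltnW // ltn_expl.
have : B / (r - 1) < (2 ^ n)%:R.
  by apply: le_lt_trans (ler_norm _) _; apply: lt_le_trans hn h2.
rewrite ltr_pdivrMr; lra.
Qed.

Section Multilinear.
Variables (R : realType) (F : finFieldType) (m k : nat) (L : 'M[F]_(m, k)).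

Definition mlin n (f : 'I_k -> 'rV[F]_n -> R) : R :=
  (#|sol L n|%:R)^-1 * \sum_(x in sol L n) \prod_(j < k) f j (x j).

Lemma t_mlin n (f : 'rV[F]_n -> R) : t L f = mlin (fun=> f).
Proof. by []. Qed.

Lemma eq_mlin n (f g : 'I_k -> 'rV[F]_n -> R) :
  (forall j x, f j x = g j x) -> mlin f = mlin g.
Proof.
by move=> fg; congr (_ * _); apply: eq_bigr => x _; apply: eq_bigr.
Qed.

Lemma sol_gt0 n : 0 < #|sol L n|%:R :> R.
Proof.
rewrite ltr0n; apply/card_gt0P; exists [ffun=> 0]; rewrite inE.
by apply/forallP => i; rewrite big1 // => j _; rewrite ffunE scaler0.
Qed.

Lemma mlin1 n : mlin (fun _ (_ : 'rV[F]_n) => 1) = 1.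
Proof.
rewrite /mlin (eq_bigr (fun=> 1)) => [|x _]; last by rewrite big1.
by rewrite sumr_const mulVf // gt_eqF // sol_gt0.
Qed.

Lemma ler_mlin n (f g : 'I_k -> 'rV[F]_n -> R) :
  (forall j x, 0 <= f j x <= g j x) -> mlin f <= mlin g.
Proof.
move=> fg; rewrite ler_wpM2l ?invr_ge0 ?(ltW (sol_gt0 _)) //.
by apply: ler_sum => x _; apply: ler_prod.
Qed.

Lemma mlin_ge0 n (f : 'I_k -> 'rV[F]_n -> R) :
  (forall j x, 0 <= f j x) -> 0 <= mlin f.
Proof.
move=> f0; rewrite mulr_ge0 ?invr_ge0 ?(ltW (sol_gt0 _)) //.
by apply: sumr_ge0 => x _; apply: prodr_ge0.
Qed.

Lemma mlin_gt0 n (f : 'I_k -> 'rV[F]_n -> R) :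
  (forall j x, 0 < f j x) -> 0 < mlin f.
Proof.
move=> f0; rewrite mulr_gt0 ?invr_gt0 ?sol_gt0 //.
have /card_gt0P[x0 sx0] : (0 < #|sol L n|)%N by have := sol_gt0 n; rewrite ltr0n.
rewrite (bigD1 x0) //= ltr_wpDr ?prodr_gt0 //.
by apply: sumr_ge0 => x _; apply: prodr_ge0 => j _; apply: ltW.
Qed.

Lemma mlinZ n (c : 'I_k -> R) (f : 'I_k -> 'rV[F]_n -> R) :
  mlin (fun j x => c j * f j x) = \prod_j c j * mlin f.
Proof.
rewrite /mlin mulrCA; congr (_ * _); rewrite mulr_sumr; apply: eq_bigr => x _.
by rewrite big_split.
Qed.

Lemma mlinZc n (c : R) (f : 'I_k -> 'rV[F]_n -> R) :
  mlin (fun j x => c * f j x) = c ^+ k * mlin f.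
Proof. by rewrite (mlinZ (fun=> c)) prodr_const card_ord. Qed.

(** Solutions in dimension [n + n] are pairs of solutions in dimension [n], so the form is
    multiplicative on tensor products. *)
Lemma mlin_row_mx n (f : 'I_k -> 'rV[F]_n -> R) :
  mlin (fun j (x : 'rV_(n + n)) => f j (lsubmx x) * f j (rsubmx x))
    = mlin f ^+ 2.
Proof.
pose U n' (f : 'I_k -> 'rV[F]_n' -> R) :=
  \sum_(x in sol L n') \prod_(j < k) f j (x j).
(* The unnormalised identity also counts the solutions, on taking [f' = 1]. *)
suff HU f' : U _ (fun j (x : 'rV_(n + n)) => f' j (lsubmx x) * f' j (rsubmx x))
    = U n f' ^+ 2.
  have card_sol n' : #|sol L n'|%:R = U n' (fun _ _ => 1).
    by rewrite /U (eq_bigr (fun=> 1)) => [|x _]; rewrite ?sumr_const ?big1.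
  rewrite /mlin; have -> : #|sol L (n + n)|%:R = #|sol L n|%:R ^+ 2 :> R.
    rewrite !card_sol -HU; apply: eq_bigr => x _; apply: eq_bigr => j _.
    by rewrite mulr1.
  by rewrite exprMn exprVn -[X in _ = _ * X](HU f).
rewrite expr2 /U big_distrlr /= pair_big /=.
pose h (p : {ffun 'I_k -> 'rV[F]_n} * {ffun 'I_k -> 'rV[F]_n}) :=
  [ffun j => row_mx (p.1 j) (p.2 j)].
pose h' (x : {ffun 'I_k -> 'rV[F]_(n + n)}) :=
  ([ffun j => lsubmx (x j)], [ffun j => rsubmx (x j)]).
rewrite (reindex h) /=; last first.
  exists h' => [[x y]|x] _; rewrite /h /h' /=.
    by congr pair; apply/ffunP => j; rewrite !ffunE /= ?row_mxKl ?row_mxKr.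
  by apply/ffunP => j; rewrite !ffunE hsubmxK.
apply: eq_big => [[x y]|[x y] _] /=.
  rewrite !inE.
  have E i : (\sum_(j < k) L i j *: h (x, y) j == 0) =
      (\sum_(j < k) L i j *: x j == 0) && (\sum_(j < k) L i j *: y j == 0).
    rewrite -(hsubmxK (\sum_(j < k) _)) row_mx_eq0 !linear_sum.
    by congr (_ && _); congr (_ == _); apply: eq_bigr => j _;
      rewrite linearZ /= ffunE ?row_mxKl ?row_mxKr.
  apply/forallP/andP => [H|[/forallP Hx /forallP Hy] i]; last by rewrite E Hx Hy.
  by split; apply/forallP => i; have := H i; rewrite E => /andP[].
by rewrite -big_split; apply: eq_bigr => j _ /=; rewrite ffunE row_mxKl row_mxKr.
Qed.

End Multilinear.

(** * Hölder's inequality *)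

Section Norm.
Variables (R : realType) (F : finFieldType) (m k : nat) (L : 'M[F]_(m, k)).
Hypotheses (k_gt0 : (0 < k)%N) (normL : @weakly_norming R F m k L).

Lemma powR_root (x : R) : 0 <= x -> (x `^ k%:R^-1) ^+ k = x.
Proof.
move=> x0; rewrite -powR_mulrn ?powR_ge0 // -powRrM mulVf ?powRr1 //.
by rewrite pnatr_eq0 -lt0n.
Qed.

(** This is the triangle inequality for the norm, raised to the power [k]: each summand has norm at
    most the [k]-th root of [M]. *)
Lemma t_sum_le n (I : finType) (A : {pred I}) (f : I -> 'rV[F]_n -> R) (M : R) :
    (0 < n)%N -> 0 <= M -> (forall i x, 0 <= f i x) ->
    (forall i, i \in A -> t L (f i) <= M) ->
  t L (fun x => \sum_(i in A) f i x) <= #|A|%:R ^+ k * M.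
Proof.
move=> n0 M0 f0 fM.
pose N (g : 'rV[F]_n -> R) := t L (fun x => `|g x|) `^ k%:R^-1.
have [_ _ Nhom Ntri] : is_norm N := normL n0.
have extN g h : (forall x, g x = h x) -> N g = N h.
  by move=> gh; congr (_ `^ _); rewrite !t_mlin; apply: eq_mlin => _ x; rewrite gh.
have NE g : (forall x, 0 <= g x) -> N g = t L g `^ k%:R^-1.
  by move=> g0; congr (_ `^ _); rewrite !t_mlin; apply: eq_mlin => _ x; rewrite ger0_norm.
have Nsum (s : seq I) : N (fun x => \sum_(i <- s) f i x) <= \sum_(i <- s) N (f i).
  elim: s => [|i s IH].
    rewrite big_nil (extN _ (fun x => 0 * 0)) => [|x]; last by rewrite big_nil mul0r.
    by rewrite Nhom normr0 mul0r.
  rewrite big_cons (extN _ (fun x => f i x + \sum_(j <- s) f j x)) => [|x]; last first.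
    by rewrite big_cons.
  by apply: le_trans (Ntri _ _) _; rewrite lerD2l.
have tge0 g : (forall x, 0 <= g x) -> 0 <= t L g.
  by move=> g0; rewrite t_mlin mlin_ge0.
have sum0 x : 0 <= \sum_(i in A) f i x by apply: sumr_ge0.
rewrite -[leLHS]powR_root ?tge0 // -NE // -[X in _ <= _ * X](powR_root M0) -exprMn.
rewrite lerXn2r ?nnegrE ?powR_ge0 ?mulr_ge0 ?powR_ge0 //.
rewrite (extN _ (fun x => \sum_(i <- enum A) f i x)) => [|x]; last by rewrite big_enum.
apply: le_trans (Nsum _) _.
rewrite big_enum mulr_natl -sumr_const; apply: ler_sum => i iA.
by rewrite NE // ge0_ler_powR ?nnegrE ?invr_ge0 ?tge0 ?fM.
Qed.

(** After rescaling each [f j] to [t = 1], every factor is at most the sum of all of them, and the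
    triangle inequality bounds [t] of that sum. *)
Lemma holder_const n (f : 'I_k -> 'rV[F]_n -> R) :
    (0 < n)%N -> (forall j x, 0 < f j x) ->
  mlin L f ^+ k <= k%:R ^+ (k * k) * \prod_j t L (f j).
Proof.
move=> n0 f0; pose c j : R := (t L (f j))^-1 `^ k%:R^-1.
have t0 j : 0 < t L (f j) by rewrite t_mlin mlin_gt0.
have c0 j : 0 < c j by rewrite powR_gt0 ?invr_gt0.
have ck j : c j ^+ k = (t L (f j))^-1 by rewrite powR_root ?invr_ge0 ?ltW.
have cf0 j x : 0 <= c j * f j x by rewrite mulr_ge0 ?ltW.
have := @t_sum_le n _ 'I_k (fun j x => c j * f j x) 1 n0 ler01 cf0.
have tcf j : t L (fun x => c j * f j x) = 1.
  by rewrite t_mlin (mlinZc L (c j) (fun=> f j)) ck mulVf // gt_eqF.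
move=> /(_ _)/wrap[|H]; first by move=> j _; rewrite tcf.
rewrite card_ord mulr1 in H.
have H' : mlin L (fun j x => c j * f j x) <= k%:R ^+ k.
  apply: le_trans H; rewrite t_mlin; apply: ler_mlin => j x; rewrite cf0 /=.
  by rewrite (bigD1 j) //= lerDl sumr_ge0.
rewrite mlinZ in H'.
have pc0 : 0 < \prod_j c j by apply: prodr_gt0.
have : (\prod_j c j * mlin L f) ^+ k <= (k%:R ^+ k) ^+ k.
  rewrite lerXn2r // nnegrE ?exprn_ge0 // mulr_ge0 ?ltW //.
  exact: mlin_gt0.
rewrite exprMn -prodrXl (eq_bigr (fun j => (t L (f j))^-1)) // prodfV exprM.
by rewrite mulrC ler_pdivrMr ?prodr_gt0.
Qed.

(* Doubling the dimension squares both sides of [holder_const] while keeping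
   its constant, which can therefore be replaced by 1. *)
Lemma holder n (f : 'I_k -> 'rV[F]_n -> R) :
    (0 < n)%N -> (forall j x, 0 < f j x) ->
  mlin L f ^+ k <= \prod_j t L (f j).
Proof.
move=> n0 f0.
have P0 : 0 < \prod_j t L (f j) by apply: prodr_gt0 => j _; rewrite t_mlin mlin_gt0.
rewrite -[leRHS]mul1r -ler_pdivrMr //.
apply: (@le1_of_bounded_powers _ _ (k%:R ^+ (k * k))).
  by rewrite divr_ge0 ?exprn_ge0 ?(ltW P0) // ltW // mlin_gt0.
(* The induction generalises [n] and [f], since the step passes to the tensor squares of the [f j]
   in dimension [n + n]. *)
move=> N; elim: N n f n0 f0 P0 => [|N IH] n f n0 f0 P0.
  by rewrite expr1 ler_pdivrMr ?holder_const.
pose g j (x : 'rV_(n + n)) := f j (lsubmx x) * f j (rsubmx x).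
have tg j : t L (g j) = t L (f j) ^+ 2 by exact: (mlin_row_mx L (fun=> f j)).
have Pg : \prod_j t L (g j) = (\prod_j t L (f j)) ^+ 2.
  by rewrite -prodrXl; apply: eq_bigr.
have := IH _ g (ltn_addr _ n0) (fun j x => mulr_gt0 (f0 _ _) (f0 _ _)).
rewrite Pg (mlin_row_mx L f) exprn_gt0 // => /(_ isT).
by rewrite (exprAC (mlin L f) 2 k) -expr_div_n -exprM -expnS.
Qed.

End Norm.

(** * Expansion around positive functions *)

Lemma big_card1 (V : nmodType) (T : finType) (G : {set T} -> V) :
  \sum_(S : {set T} | #|S| == 1%N) G S = \sum_i G [set i].
Proof.
rewrite -(big_imset G (in2W set1_inj)) /=; apply: eq_bigl => S.
apply/cards1P/imsetP => [[i ->]|[i _ ->]]; by exists i.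
Qed.

Lemma bernoulli_exprD (R : realDomainType) (n : nat) (x y : R) :
  0 <= x -> 0 <= y -> x ^+ n + n%:R * x ^+ n.-1 * y <= (x + y) ^+ n.
Proof.
move=> x0 y0; elim: n => [|n IH]; first by rewrite !mul0r addr0.
rewrite [leRHS]exprS; apply: le_trans (ler_wpM2l (addr_ge0 x0 y0) IH).
rewrite exprS -natr1 mulrDl.
have : n%:R * x ^+ n <= n%:R * (x * x ^+ n.-1).
  by case: n {IH} => [|n]; rewrite ?mul0r // exprS.
have : 0 <= n%:R * x ^+ n.-1 * y * y by rewrite !mulr_ge0 ?exprn_ge0.
move=> h1 /(ler_wpM2r y0); move: h1; move: (x ^+ n) (x ^+ n.-1) (n%:R) => a b c.
lra.
Qed.

Section Expansion.
Variables (R : realType) (F : finFieldType) (m k : nat) (L : 'M[F]_(m, k)).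

(** The form at [u + c w] as a polynomial in [c]; [S] is the set of coordinates from which [w] is
    picked. *)
Definition mlin_poly n (u w : 'I_k -> 'rV[F]_n -> R) : {poly R} :=
  \sum_(S : {set 'I_k})
    mlin L (fun j x => if j \in S then w j x else u j x) *: 'X^#|S|.

Lemma horner_mlin_poly n (u w : 'I_k -> 'rV[F]_n -> R) (c : R) :
  (mlin_poly u w).[c] = mlin L (fun j x => u j x + c * w j x).
Proof.
rewrite horner_sum /mlin.
under [in RHS]eq_bigr do under eq_bigr do rewrite addrC.
under [in RHS]eq_bigr do rewrite bigA_distr.
rewrite exchange_big mulr_sumr; apply: eq_bigr => S _ /=.
rewrite hornerZ hornerXn -mulrA; congr (_ * _); rewrite mulr_suml.
apply: eq_bigr => x _; rewrite mulrC -prodr_const [X in X * _]big_mkcond.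
by rewrite -big_split; apply: eq_bigr => j _ /=; case: ifP; rewrite // mul1r.
Qed.

Lemma coef_mlin_poly n (u w : 'I_k -> 'rV[F]_n -> R) (d : nat) :
  (mlin_poly u w)`_d = \sum_(S : {set 'I_k} | #|S| == d)
    mlin L (fun j x => if j \in S then w j x else u j x).
Proof.
rewrite coef_sum [RHS]big_mkcond; apply: eq_bigr => S _ /=.
by rewrite coefZ coefXn eq_sym; case: eqP; rewrite ?mulr1 ?mulr0.
Qed.

Lemma coef0_mlin_poly n (u w : 'I_k -> 'rV[F]_n -> R) :
  (mlin_poly u w)`_0 = mlin L u.
Proof.
rewrite coef_mlin_poly (big_pred1 set0) => [|S]; last by rewrite /= cards_eq0.
by apply: eq_mlin => j x; rewrite inE.
Qed.

Lemma mlinD_at n (f : 'I_k -> 'rV[F]_n -> R) (h : 'rV[F]_n -> R) (a : 'I_k)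
    (c : R) :
  mlin L (fun j x => if j == a then f j x + c * h x else f j x)
    = mlin L f + c * mlin L (fun j x => if j == a then h x else f j x).
Proof.
rewrite /mlin mulrCA -mulrDr; congr (_ * _).
rewrite mulr_sumr -big_split /=.
apply: eq_bigr => x _; rewrite (bigD1 a) //= [X in _ = X + _](bigD1 a) //=.
rewrite [X in _ = _ + _ * X](bigD1 a) //= !eqxx mulrDl mulrA.
by congr (_ * _ + _ * _); apply: eq_bigr => j /negPf ->.
Qed.

Hypotheses (k_gt0 : (0 < k)%N) (normL : @weakly_norming R F m k L).

(* First-order consequence of Holder's inequality for [f + c] in coordinate [a]
   and [f] elsewhere; summing over [a] shows that it is an equality. *)
Lemma mlin_replace1_le n (f : 'rV[F]_n -> R) (a : 'I_k) :
    (0 < n)%N -> (forall x, 0 < f x) ->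
  k%:R * mlin L (fun j x => if j == a then 1 else f x)
    <= \sum_i mlin L (fun j x => if j == i then 1 else f x).
Proof.
move=> n0 f0; set P := fun i => mlin L (fun j x => if j == i then 1 else f x).
rewrite -[mlin L _]/(P a) -[leRHS]/(\sum_i P i).
pose T := mlin L (fun=> f).
have T0 : 0 < T by apply: mlin_gt0.
have P0 i : 0 <= P i by apply: mlin_ge0 => j x; case: ifP => // _; apply: ltW.
(* Hölder gives [(T + c P a)^k <= T^(k-1) t(f + c)], and Bernoulli bounds the left side below by
   [T^k + k T^(k-1) c P a]. Hence [q] is non-negative for [c > 0] and vanishes at [0]; its linear
   coefficient is the claim times [T^(k-1)]. *)
pose q := T ^+ k.-1 *: mlin_poly (fun=> f) (fun _ _ => 1)
  - (T ^+ k)%:P - (k%:R * T ^+ k.-1 * P a) *: 'X.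
have Tk : T ^+ k.-1 * T = T ^+ k by rewrite -exprSr prednK.
have q0 i : (i < 1)%N -> q`_i = 0.
  case: i => // _; rewrite !coefB !coefZ coefC coefX coef0_mlin_poly /=.
  by rewrite mulr0 subr0 Tk subrr.
have := coef_ge0_of_horner_ge0 ltr01 q0.
rewrite !coefB !coefZ coefC coefX coef_mlin_poly big_card1 /= subr0 mulr1.
have -> : \sum_i mlin L (fun j x => if j \in [set i] then 1 else f x) = \sum_i P i.
  by apply: eq_bigr => i _; apply: eq_mlin => j x; rewrite inE.
rewrite (mulrC k%:R) -mulrA -mulrBr pmulr_rge0 ?exprn_gt0 // subr_ge0; apply.
move=> c /andP[c0 _].
pose g j x := if j == a then f x + c else f x.
have g0 j x : 0 < g j x by rewrite /g; case: ifP => // _; rewrite addr_gt0.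
have := holder k_gt0 normL n0 g0.
have -> : mlin L g = T + c * P a.
  rewrite -(mlinD_at (fun=> f) (fun=> 1)); apply: eq_mlin => j x.
  by rewrite mulr1.
have -> : \prod_j t L (g j) = T ^+ k.-1 * (mlin_poly (fun=> f) (fun _ _ => 1)).[c].
  rewrite (bigD1 a) //= mulrC; congr (_ * _).
    rewrite (eq_bigr (fun=> T)) => [|j /negPf ja]; last first.
      by rewrite t_mlin; apply: eq_mlin => i x; rewrite /g ja.
    by rewrite prodr_const cardC1 card_ord.
  rewrite horner_mlin_poly t_mlin; apply: eq_mlin => i x.
  by rewrite /g eqxx mulr1.
move=> H; have := le_trans (bernoulli_exprD k (ltW T0) (mulr_ge0 (ltW c0) (P0 a))) H.
rewrite /q 2!hornerD !hornerN !hornerZ hornerC hornerX.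
by move: (P a) => Pa ?; lra.
Qed.

End Expansion.

(** * Characters *)

(** A root of [1 + X + ... + X^(p-1)] has order dividing [p], and it is not [1], where this
    polynomial takes the value [p]. *)
Lemma prime_primitive_root_exists (C : numClosedFieldType) (p : nat) :
  prime p -> exists w : C, p.-primitive_root w.
Proof.
move=> p_pr; have p0 := prime_gt0 p_pr.
have [w] : exists w, root (\poly_(i < p) (1 : C)) w.
  apply/closed_rootP; rewrite size_poly_eq ?oner_eq0 //; apply/eqP => p1.
  by rewrite p1 in p_pr.
rewrite /root horner_poly => /eqP w_root.
have w_root' : \sum_(i < p) w ^+ i = 0.
  by rewrite -[RHS]w_root; apply: eq_bigr => i _; rewrite mul1r.
have wp : w ^+ p = 1 by apply/eqP; rewrite -subr_eq0 subrX1 w_root' mulr0.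
have [d wd dp] := prim_order_exists p0 wp.
have /orP[/eqP d1|/eqP dE] : (d == 1%N) || (d == p) by case/primeP: p_pr => _; apply.
  move: (prim_expr_order wd); rewrite d1 expr1 => w1.
  move: w_root'; rewrite w1 (eq_bigr (fun=> 1)) => [|i _]; last by rewrite expr1n.
  by move/eqP; rewrite sumr_const card_ord pnatr_eq0 eqn0Ngt p0.
by exists w; rewrite -dE.
Qed.

(** View [F] as a vector space over its prime field and compose a coordinate that does not vanish at
    [1] with the powers of a primitive [p]-th root of unity. *)
Lemma additive_character_exists (C : numClosedFieldType) (F : finFieldType) :
  exists e : F -> C,
    [/\ forall x y, e (x + y) = e x * e y, forall x, `|e x| = 1
      & exists x, e x != 1].
Proof.
have [p p_pr pF] := finPcharP F.
pose V := pPrimeCharType pF.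
have [w w_prim] := prime_primitive_root_exists C p_pr.
have := coord_vbasis (memvf (1 : V)).
have [i ci0 _|c0] := pickP (fun i => coord (vbasis fullv) i (1 : V) != 0); last first.
  rewrite big1 => [/eqP|i _]; first by rewrite oner_eq0.
  by have /negbFE/eqP -> := c0 i; rewrite scale0r.
pose tr (x : V) : 'F_p := coord (vbasis fullv) i x.
have wn : w ^+ p = 1 := prim_expr_order w_prim.
exists (fun x => w ^+ (tr x : nat)); split.
- move=> x y; rewrite -exprD /tr linearD /=.
  rewrite -[RHS](expr_mod _ wn); congr (w ^+ (_ %% _)); exact: Fp_cast.
- move=> x; apply/eqP; rewrite -(@pexpr_eq1 _ _ p) ?prime_gt0 // -normrX.
  by rewrite -exprM mulnC exprM wn expr1n normr1.
- exists 1; rewrite -(prim_order_dvd w_prim); apply: contra ci0 => /dvdnP[q qE].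
  apply/eqP/val_inj => /=; rewrite -/(tr 1).
  have := ltn_ord (tr 1); rewrite qE [X in (_ < X)%N]Fp_cast //.
  by case: q {qE} => // q; rewrite mulSn ltnNge leq_addr.
Qed.

(** * Fourier expansion of the multilinear form *)

Section Spectral.
Variables (R : realType) (F : finFieldType) (m k : nat) (L : 'M[F]_(m, k)).
Local Open Scope complex_scope.
Variable e : F -> R[i].
Hypotheses (eD : forall x y, e (x + y) = e x * e y)
  (e_neq0 : forall x, e x != 0) (e_neq1 : exists x, e x != 1).

Lemma char0 : e 0 = 1.
Proof. by apply: (mulfI (e_neq0 0)); rewrite -eD addr0 mulr1. Qed.

Lemma char_sum (I : finType) (c : I -> F) : e (\sum_i c i) = \prod_i e (c i).
Proof. exact: (big_morph e eD char0). Qed.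

Lemma sol1E (x : {ffun 'I_k -> 'rV[F]_1}) :
  (x \in sol L 1) = (L *m (\col_j x j 0 0) == 0).
Proof.
rewrite inE; apply/forallP/eqP => [H|H i].
  apply/matrixP => i j; rewrite !mxE; have /eqP/matrixP/(_ 0 0) := H i.
  by rewrite summxE mxE => E; rewrite -[RHS]E; apply: eq_bigr => l _; rewrite !mxE.
apply/eqP/matrixP => a b; rewrite !ord1.
move/matrixP: H => /(_ i 0); rewrite !mxE summxE => E; rewrite -[RHS]E.
by apply: eq_bigr => l _; rewrite !mxE.
Qed.

(** Orthogonality: a row-space vector is orthogonal to every solution. For any other [v], some
    solution [y] has [v . y = c] with [e c != 1], and translation by [y] multiplies the sum by
    [e c]. *)
Lemma sum_char_sol (v : 'rV[F]_k) :
  \sum_(x in sol L 1) e (\sum_j v 0 j * x j 0 0) =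
    if (v <= L)%MS then #|sol L 1|%:R else 0.
Proof.
pose dot (x : {ffun 'I_k -> 'rV[F]_1}) := \sum_j v 0 j * x j 0 0.
have dotE x : dot x = (v *m \col_j x j 0 0) 0 0.
  by rewrite mxE; apply: eq_bigr => j _; rewrite mxE.
case: ifPn => [/submxP[D vE]|vL].
  rewrite (eq_bigr (fun=> 1)) => [|x]; first by rewrite sumr_const.
  by rewrite -/(dot x) dotE sol1E vE -mulmxA => /eqP ->; rewrite mulmx0 mxE char0.
have [c ec] := e_neq1.
have [j vj] : exists j, (v *m cokermx L) 0 j != 0.
  apply/existsP; apply: contraR vL; rewrite negb_exists submxE => /forallP H.
  by apply/eqP/rowP => j; apply/eqP; rewrite !mxE; have := H j; rewrite negbK mxE.
have colM m' (A : 'M_(m', k)) : A *m col j (cokermx L) = col j (A *m cokermx L).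
  by rewrite !colE mulmxA.
(* A column of [cokermx L] solves the system; this one is not orthogonal to [v] and is scaled to
   give [dot y = c]. *)
pose y : {ffun 'I_k -> 'rV[F]_1} :=
  [ffun l => (c / (v *m cokermx L) 0 j * cokermx L l j)%:M].
have yE : \col_l y l 0 0 = (c / (v *m cokermx L) 0 j) *: col j (cokermx L).
  by apply/colP => l; rewrite !mxE ffunE !mxE eqxx.
have ysol : y \in sol L 1.
  by rewrite sol1E yE -scalemxAr colM mulmx_coker col0 scaler0.
have doty : dot y = c.
  by rewrite dotE yE -scalemxAr colM mxE [X in _ * X = _]mxE mulfVK.
apply: (mulfI (_ : e c - 1 != 0)); first by rewrite subr_eq0.
rewrite mulr0 mulrBl mul1r mulr_sumr; apply/eqP; rewrite subr_eq0; apply/eqP.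
rewrite [RHS](reindex (fun x : {ffun 'I_k -> 'rV[F]_1} => x + y)) /=; last first.
  by exists (fun x => x - y) => x _; rewrite ?addrK ?subrK.
apply: eq_big => x.
  rewrite !sol1E.
  have -> : \col_l (x + y) l 0 0 = \col_l x l 0 0 + \col_l y l 0 0.
    by apply/colP => l; rewrite !mxE ffunE mxE.
  by move: ysol; rewrite sol1E mulmxDr => /eqP ->; rewrite addr0.
move=> _; rewrite -/(dot x) -/(dot (x + y)) mulrC -doty -eD; congr (e _).
rewrite /dot -big_split; apply: eq_bigr => l _.
by rewrite [(x + y) l]ffunE [X in _ = _ * X]mxE mulrDr.
Qed.

Definition has_spectrum (f : 'rV[F]_1 -> R) (a : F -> R[i]) :=
  forall x, (f x)%:C = \sum_l a l * e (l * x 0 0).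

(** Expand every factor in characters; by orthogonality only the frequency vectors in the row space
    survive. *)
Lemma mlin_spectrum (f : 'I_k -> 'rV[F]_1 -> R) (a : 'I_k -> F -> R[i]) :
    (forall j, has_spectrum (f j) (a j)) ->
  (mlin L f)%:C = \sum_(c : {ffun 'I_k -> F} | (\row_j c j <= L)%MS)
    \prod_j a j (c j).
Proof.
move=> fa; rewrite /mlin rmorphM fmorphV rmorph_nat rmorph_sum /=.
under eq_bigr do rewrite rmorph_prod /=.
under eq_bigr do under eq_bigr do rewrite fa.
under eq_bigr do rewrite bigA_distr_bigA /=.
rewrite exchange_big mulr_sumr [RHS]big_mkcond; apply: eq_bigr => c _ /=.
under eq_bigr do rewrite big_split /= -char_sum.
rewrite -mulr_sumr mulrCA.
have -> : \sum_(x in sol L 1) e (\sum_j c j * x j 0 0) =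
    if (\row_j c j <= L)%MS then #|sol L 1|%:R else 0.
  rewrite -sum_char_sol; apply: eq_bigr => x _; congr (e _).
  by apply: eq_bigr => j _; rewrite mxE.
case: ifP; rewrite ?mulr0 // mulVf ?mulr1 //.
by rewrite -(rmorph_nat (real_complex R)) fmorph_eq0 gt_eqF // sol_gt0.
Qed.

End Spectral.

(** * The leading term at the girth *)

Section Girth.
Variables (F : finFieldType) (m k : nat) (L : 'M[F]_(m, k)).

Lemma girth_le (v : 'rV[F]_k) :
  (v <= L)%MS -> v != 0 -> (girth L <= #|supp v|)%N.
Proof.
by move=> vL v0; rewrite /girth -minEnat -leEnat bigmin_le_cond ?vL.
Qed.

Lemma supp_eq0 (v : 'rV[F]_k) : (supp v == set0) = (v == 0).
Proof.
apply/eqP/eqP => [/setP s0|->]; last by apply/setP => j; rewrite !inE mxE eqxx.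
by apply/rowP => j; have := s0 j; rewrite !inE mxE => /negbFE/eqP.
Qed.

Lemma mu_witness (v : 'rV[F]_k) :
  (v <= L)%MS -> v != 0 -> exists w, w \in mu L.
Proof.
move=> vL v0; pose P (w : 'rV[F]_k) := (w <= L)%MS && (w != 0).
have Pv : P v by rewrite /P vL.
pose w := [arg min_(w < v | P w) #|supp w|].
have [Pw minw] : P w /\ forall u, P u -> (#|supp w| <= #|supp u|)%N.
  by rewrite /w; case: arg_minnP.
exists w; have /andP[wL w0] := Pw; rewrite inE wL w0 eqn_leq girth_le //= andbT.
rewrite /girth; elim/big_ind: _ => [|a b ha hb|u Pu].
- exact: leq_trans (max_card _) (eq_leq (card_ord _)).
- by rewrite leq_min ha.
- exact: minw.
Qed.

Lemma girth_gt0 (v : 'rV[F]_k) : v \in mu L -> (0 < girth L)%N.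
Proof.
rewrite inE => /and3P[_ v0 /eqP <-].
by rewrite lt0n cards_eq0 supp_eq0.
Qed.

(** A row-space vector supported on [j] alone forces [x j = 0] on all solutions. The indicator of
    the non-zero points then has norm [0], against definiteness. *)
Lemma girth_gt1 (R : realType) (v : 'rV[F]_k) :
  @weakly_norming R F m k L -> v \in mu L -> (1 < girth L)%N.
Proof.
move=> normL v_mu; have := girth_gt0 v_mu; rewrite leq_eqVlt => /orP[/eqP g1|//].
move: v_mu; rewrite inE -g1 => /and3P[vL v0 /cards1P[j sv]].
have vj : v 0 j != 0.
  have : j \in supp v by rewrite sv set11.
  by rewrite inE.
have x0 (x : {ffun 'I_k -> 'rV[F]_1}) : x \in sol L 1 -> x j = 0.
  rewrite sol1E => /eqP Lx; case/submxP: vL => D vE.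
  have : (v *m \col_l x l 0 0) 0 0 = 0 by rewrite vE -mulmxA Lx mulmx0 mxE.
  rewrite mxE (bigD1 j) //= big1 ?addr0 => [|l lj].
    rewrite mxE => /eqP; rewrite mulf_eq0 (negPf vj) /= => /eqP E.
    by apply/rowP => i; rewrite ord1 E mxE.
  have : l \notin supp v by rewrite sv inE.
  by rewrite inE negbK => /eqP ->; rewrite mul0r.
have [_ def _ _] := normL 1%N isT.
pose f (x : 'rV[F]_1) : R := (x != 0)%:R.
have tf : t L (fun x => `|f x|) = 0.
  rewrite /t big1 ?mulr0 // => x /x0 xj.
  by rewrite (bigD1 j) //= /f xj eqxx normr0 mul0r.
have := def f; rewrite tf powR0 ?invr_eq0 ?pnatr_eq0 => [/(_ erefl (const_mx 1))|].
  rewrite /f; case: eqP => [/rowP/(_ 0)/eqP|_ /eqP]; last by rewrite oner_eq0.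
  by rewrite !mxE oner_eq0.
by case: (k) j {v vL v0 sv vj x0 tf def} => // -[].
Qed.

End Girth.

(** * The leading coefficient and its inequalities *)

Section Characters.
Variables (R : realType) (F : finFieldType) (m k : nat) (L : 'M[F]_(m, k)).
Local Open Scope complex_scope.
Variable e : F -> R[i].
Hypotheses (eD : forall x y, e (x + y) = e x * e y)
  (e_norm : forall x, `|e x| = 1) (e_neq1 : exists x, e x != 1).

Lemma char_neq0 x : e x != 0.
Proof. by rewrite -normr_eq0 e_norm oner_eq0. Qed.

Lemma charN x : e (- x) = (e x)^*%C.
Proof.
have -> : e (- x) = (e x)^-1.
  apply: (mulfI (char_neq0 x)); rewrite mulfV ?char_neq0 // -eD subrr.
  exact: (char0 eD char_neq0).
by rewrite invc_norm e_norm expr1n invr1 mul1r.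
Qed.

Definition partial_mlin (g : 'rV[F]_1 -> R) (S : {set 'I_k}) : R :=
  mlin L (fun j x => if j \in S then g x else 1).

(** The coefficient of [c^l] in [t(1 + c g)], with [l] the girth. *)
Definition leading (g : 'rV[F]_1 -> R) : R :=
  \sum_(S : {set 'I_k} | #|S| == girth L) partial_mlin g S.

Definition leading_at (g : 'rV[F]_1 -> R) (a : 'I_k) : R :=
  \sum_(S : {set 'I_k} | (#|S| == girth L) && (a \in S)) partial_mlin g S.

(** The constant [1] off [S] only has frequency [0], and [a 0 = 0] excludes frequency [0] on [S], so
    the surviving vectors have support exactly [S]. *)
Lemma partial_mlin_spectrum (g : 'rV[F]_1 -> R) (a : F -> R[i]) (S : {set 'I_k}) :
    has_spectrum e g a -> a 0 = 0 ->
  (partial_mlin g S)%:C =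
    \sum_(v : 'rV[F]_k | (v <= L)%MS && (supp v == S)) \prod_(j in S) a (v 0 j).
Proof.
move=> ga a0.
pose b j l : R[i] := if j \in S then a l else (l == 0)%:R.
rewrite /partial_mlin (mlin_spectrum L eD char_neq0 e_neq1 (a := b)); last first.
  move=> j x; rewrite /b; case: ifP => _; first exact: ga.
  rewrite (bigD1 0) //= eqxx mul0r (char0 eD char_neq0) mul1r big1 ?addr0 //.
  by move=> l /negPf ->; rewrite mul0r.
rewrite (reindex (fun v : 'rV[F]_k => [ffun j => v 0 j])) /=; last first.
  exists (fun c : {ffun 'I_k -> F} => \row_j c j) => [v|c] _.
    by apply/rowP => j; rewrite mxE ffunE.
  by apply/ffunP => j; rewrite ffunE mxE.
rewrite big_mkcond [RHS]big_mkcond; apply: eq_bigr => v _.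
have -> : \row_j [ffun j => v 0 j] j = v by apply/rowP => j; rewrite mxE ffunE.
case: ifP => //= _; case: eqP => [sv|sv].
  rewrite [RHS]big_mkcond; apply: eq_bigr => j _; rewrite /b ffunE.
  by case: ifPn => //; rewrite -sv inE negbK => ->.
apply/eqP/prodf_eq0.
have [j] : exists j, (j \in supp v) != (j \in S).
  apply/existsP; apply: contra_notT sv; rewrite negb_exists => /forallP H.
  by apply/setP => j; apply/eqP; have := H j; rewrite negbK.
rewrite inE => jS; exists j => //; rewrite /b ffunE.
by case: ifP jS => _; case: (v 0 j =P 0) => // ->; rewrite a0.
Qed.

Lemma partial_mlin0 g : partial_mlin g set0 = 1.
Proof.
by rewrite -(mlin1 R L 1); apply: eq_mlin => j x; rewrite inE.
Qed.

Lemma partial_mlin_eq0 g a (S : {set 'I_k}) : has_spectrum e g a -> a 0 = 0 ->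
  (0 < #|S| < girth L)%N -> partial_mlin g S = 0.
Proof.
move=> ga a0 /andP[S0 Sl]; apply: (@complexI R).
rewrite (partial_mlin_spectrum S ga a0) big1 // => v /andP[vL /eqP sv].
have v0 : v != 0 by rewrite -supp_eq0 sv -cards_eq0 -lt0n.
by have := girth_le vL v0; rewrite sv leqNgt Sl.
Qed.

Lemma perturb_gt0 (g : 'rV[F]_1 -> R) :
  exists2 r : R, 0 < r & forall c, 0 < c < r -> forall x, 0 < 1 + c * g x.
Proof.
pose B := 1 + \sum_x `|g x|.
have B0 : 0 < B by rewrite ltr_wpDr ?sumr_ge0.
exists B^-1; rewrite ?invr_gt0 // => c /andP[c0 cB] x.
have cB1 : c * B < 1 by rewrite -ltr_pdivlMr // mul1r.
have gB : `|g x| <= B.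
  by rewrite /B (bigD1 x) //= addrCA lerDl addr_ge0 ?sumr_ge0.
have : - B <= g x by apply: lerNnormlW.
move=> /(ler_wpM2l (ltW c0)); lra.
Qed.

Definition one_poly (g : 'rV[F]_1 -> R) : {poly R} :=
  mlin_poly L (fun _ _ => 1) (fun=> g).

Lemma coef_one_poly g a i : has_spectrum e g a -> a 0 = 0 ->
  (i < girth L)%N -> (one_poly g)`_i = (i == 0%N)%:R.
Proof.
move=> ga a0 il; case: (posnP i) => [->|i0].
  by rewrite coef0_mlin_poly mlin1.
rewrite coef_mlin_poly big1 // => S /eqP Si.
by apply: (partial_mlin_eq0 ga a0); rewrite Si i0.
Qed.

Lemma coef_one_poly_girth g : (one_poly g)`_(girth L) = leading g.
Proof. exact: coef_mlin_poly. Qed.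

Lemma sum_leading_at g : \sum_a leading_at g a = (girth L)%:R * leading g.
Proof.
rewrite /leading_at /leading (exchange_big_dep (fun S : {set 'I_k} => #|S| == girth L)) /=.
  rewrite mulr_sumr; apply: eq_bigr => S /eqP Sl.
  by rewrite Sl eqxx sumr_const Sl mulr_natl.
by move=> a S _ /andP[].
Qed.

Hypotheses (normL : @weakly_norming R F m k L) (v0 : 'rV[F]_k)
  (v0_mu : v0 \in mu L).

Lemma mu_dim_gt0 : (0 < k)%N.
Proof.
move: v0_mu; rewrite inE => /and3P[_ + _]; rewrite -supp_eq0.
by case/set0Pn => j _; apply: leq_ltn_trans (ltn_ord j).
Qed.

(** Apply Hölder to [1 + c g] in one coordinate and [1] elsewhere. As the girth exceeds [1], the
    form equals [1] there, so [t(1 + c g) >= 1]. *)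
Lemma leading_ge0 g a : has_spectrum e g a -> a 0 = 0 -> 0 <= leading g.
Proof.
move=> ga a0; have [r r0 Hr] := perturb_gt0 g.
have k0 := mu_dim_gt0; pose j0 := Ordinal k0.
have l1 := girth_gt1 normL v0_mu.
suff : 0 <= (one_poly g - 1)`_(girth L).
  by rewrite coefB coef1 coef_one_poly_girth gtn_eqF ?subr0 // ltnW.
apply: (coef_ge0_of_horner_ge0 r0) => [i il|c cr].
  by rewrite coefB coef1 (coef_one_poly ga a0 il) subrr.
rewrite hornerD hornerN hornerC subr_ge0 horner_mlin_poly.
pose f j x := if j == j0 then 1 + c * g x else 1.
have f0 j x : 0 < f j x by rewrite /f; case: ifP => _; rewrite ?Hr.
have := holder k0 normL (ltn0Sn 0) f0.
rewrite (bigD1 j0) //= big1 ?mulr1 => [|j /negPf jj]; last first.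
  by rewrite t_mlin -(mlin1 R L 1); apply: eq_mlin => i x; rewrite /f jj.
rewrite t_mlin /f eqxx (mlinD_at L (fun _ _ => 1)) mlin1.
rewrite (_ : mlin L _ = partial_mlin g [set j0]); last first.
  by apply: eq_mlin => j x; rewrite inE.
by rewrite (partial_mlin_eq0 ga a0) ?cards1 // mulr0 addr0 expr1n.
Qed.

(** Replacing coordinate [i] of [1 + c g] by [1] removes the sets containing [i], leaving [G - G_i]
    as coefficient at the girth. The first-order Hölder inequality then reads
    [k (G - G_i0) <= k G - l G]. *)
Lemma leading_le_at g a (i0 : 'I_k) : has_spectrum e g a -> a 0 = 0 ->
  (girth L)%:R * leading g <= k%:R * leading_at g i0.
Proof.
move=> ga a0; have [r r0 Hr] := perturb_gt0 g.
have k0 := mu_dim_gt0.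
pose p i := mlin_poly L (fun _ _ => 1) (fun j x => if j == i then 0 else g x).
have coef_p i d : (p i)`_d
    = \sum_(S : {set 'I_k} | (#|S| == d) && (i \notin S)) partial_mlin g S.
  rewrite coef_mlin_poly big_mkcondr; apply: eq_bigr => S _.
  case: ifPn => [iS|]; last first.
    rewrite negbK => iS; rewrite /mlin big1 ?mulr0 // => x _.
    by rewrite (bigD1 i) //= iS eqxx mul0r.
  apply: eq_mlin => j x; case: ifP => // jS.
  by case: eqP jS iS => // -> ->.
have coef_p_lt i d : (d < girth L)%N -> (p i)`_d = (d == 0%N)%:R.
  move=> dl; case: (posnP d) => [->|d0]; first by rewrite coef0_mlin_poly mlin1.
  rewrite coef_p big1 // => S /andP[/eqP Sd _].
  by apply: (partial_mlin_eq0 ga a0); rewrite Sd d0.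
have coef_p_girth i : (p i)`_(girth L) = leading g - leading_at g i.
  rewrite coef_p /leading_at [leading g](bigID (fun S : {set 'I_k} => i \in S)) /=.
  by rewrite [RHS]addrC addKr.
have : 0 <= (\sum_i p i - k%:R *: p i0)`_(girth L).
  apply: (coef_ge0_of_horner_ge0 r0) => [d dl|c cr].
    rewrite coefB coefZ coef_sum (eq_bigr (fun=> (d == 0%N)%:R)).
      by rewrite sumr_const card_ord coef_p_lt // mulr_natl subrr.
    by move=> i _; rewrite coef_p_lt.
  rewrite hornerD hornerN hornerZ horner_sum subr_ge0.
  have pE i : (p i).[c] = mlin L (fun j x => if j == i then 1 else 1 + c * g x).
    rewrite horner_mlin_poly; apply: eq_mlin => j x.
    by case: eqP; rewrite ?mulr0 ?addr0.
  rewrite (eq_bigr _ (fun i _ => pE i)) pE.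
  exact: (mlin_replace1_le k0 normL i0 (ltn0Sn 0) (Hr c cr)).
rewrite coefB coefZ coef_sum (eq_bigr _ (fun i _ => coef_p_girth i)) coef_p_girth.
rewrite sumrB sum_leading_at sumr_const card_ord -mulr_natl.
lra.
Qed.

End Characters.

(** * Schatten vectors *)

Section Cosines.
Variables (R : realType) (F : finFieldType) (m k : nat) (L : 'M[F]_(m, k)).
Local Open Scope complex_scope.
Variable e : F -> R[i].
Hypotheses (eD : forall x y, e (x + y) = e x * e y)
  (e_norm : forall x, `|e x| = 1) (e_neq1 : exists x, e x != 1).

Definition cosine (z : R[i]) (x : 'rV[F]_1) : R :=
  2 * complex.Re (z * e (x 0 0)).

(** A sum of two indicators, so that in characteristic 2 both terms fall on [l = 1]. *)
Definition cosine_coef (z : R[i]) (l : F) : R[i] :=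
  (l == 1)%:R * z + (l == -1)%:R * z^*%C.

Lemma cosine_coef0 z : cosine_coef z 0 = 0.
Proof.
by rewrite /cosine_coef eq_sym oner_eq0 eq_sym oppr_eq0 oner_eq0 !mul0r addr0.
Qed.

Lemma cosineE z x :
  (cosine z x)%:C = z * e (x 0 0) + z^*%C * e (- x 0 0).
Proof.
rewrite (charN eD e_norm) -rmorphM addcJ.
by rewrite /cosine rmorphM rmorph_nat.
Qed.

Lemma cosine_spectrum z : has_spectrum e (cosine z) (cosine_coef z).
Proof.
move=> x; rewrite cosineE.
under [RHS]eq_bigr do rewrite mulrDl -!mulrA.
rewrite big_split /= (bigD1 1) //= eqxx !mul1r big1 => [|l /negPf ->]; last first.
  by rewrite mul0r.
rewrite addr0 (bigD1 (-1)) //= eqxx mul1r mulN1r big1 ?addr0 // => l /negPf ->.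
by rewrite mul0r.
Qed.

Lemma prod_cosine_coef z (v : 'rV[F]_k) : (1 : F) != -1 ->
    (forall j, v 0 j \in [:: 0; 1; -1]) ->
  \prod_(j in supp v) cosine_coef z (v 0 j)
    = z ^+ #|[set j | v 0 j == 1]| * z^*%C ^+ #|[set j | v 0 j == -1]|.
Proof.
move=> neq1 hv; rewrite -!prodr_const [LHS]big_mkcond [X in _ = X * _]big_mkcond.
rewrite [X in _ = _ * X]big_mkcond -big_split /=.
apply: eq_bigr => j _; rewrite !inE /cosine_coef.
have := hv j; rewrite !inE => /or3P[] /eqP ->.
- by rewrite eqxx eq_sym oner_eq0 eq_sym oppr_eq0 oner_eq0 /= mul1r.
- by rewrite oner_eq0 eqxx (negPf neq1) mul1r mul0r addr0 mulr1.
- by rewrite oppr_eq0 oner_eq0 eqxx eq_sym (negPf neq1) mul0r add0r ?mul1r.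
Qed.

(** An entry outside [{0, 1, -1}] kills each product. Otherwise, with [a] entries [1] and [b]
    entries [-1], the sum is geometric with ratio [w^(a-b)]; since [a] and [b] differ and are below
    [p], the ratio is not [1]. *)
Lemma sum_prod_cosine_coef (p : nat) (w : R[i]) (v : 'rV[F]_k) :
    (k < p)%N -> p.-primitive_root w -> `|w| = 1 -> ~~ schatten v ->
  \sum_(i < p) \prod_(j in supp v) cosine_coef (w ^+ i) (v 0 j) = 0.
Proof.
move=> kp wp w1 nsv.
have [hv|] := boolP [forall j, v 0 j \in [:: 0; 1; -1]]; last first.
  rewrite negb_forall => /existsP[j]; rewrite !inE !negb_or => /and3P[v0 v1 vN1].
  apply: big1 => i _; rewrite (bigD1 j) ?inE //= /cosine_coef.
  by rewrite (negPf v1) (negPf vN1) !mul0r addr0 mul0r.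
pose a := #|[set j | v 0 j == 1]|; pose b := #|[set j | v 0 j == -1]|.
have ab : a != b.
  by apply: contra nsv => ab; apply/existsP; exists 1; rewrite hv.
(* In characteristic 2 the counts [a] and [b] would coincide. *)
have neq1 : (1 : F) != -1 by apply: contraNneq ab => E; rewrite /a /b -E.
have w0 : w != 0 by rewrite -normr_eq0 w1 oner_eq0.
have wJ : w^*%C = w^-1 by rewrite invc_norm w1 expr1n invr1 mul1r.
have wpp := prim_expr_order wp.
have card_lt (A : {set 'I_k}) : (#|A| < p)%N.
  by apply: leq_ltn_trans kp; rewrite -[X in (_ <= X)%N]card_ord max_card.
pose z := w ^+ a / w ^+ b.
rewrite (eq_bigr (fun i : 'I_p => z ^+ i)) => [|i _]; last first.
  rewrite prod_cosine_coef //; last exact/forallP.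
  by rewrite rmorphXn /= wJ exprVn exprVn -!exprM -/a -/b !(mulnC i) !exprM -expr_div_n.
have z1 : z - 1 != 0.
  rewrite subr_eq0; apply: contra ab => /eqP zE.
  have : w ^+ a == w ^+ b by rewrite -[w ^+ b]mul1r -zE mulfVK // expf_neq0.
  by rewrite (eq_prim_root_expr wp) !modn_small ?card_lt.
apply: (mulfI z1); rewrite -subrX1 mulr0 /z expr_div_n -!exprM !(mulnC _ p).
by rewrite !exprM wpp !expr1n divr1 subrr.
Qed.

Hypotheses (normL : @weakly_norming R F m k L) (v0 : 'rV[F]_k)
  (v0_mu : v0 \in mu L).

(** Summed over the [p]-th roots of unity [z], the values of [G_a] cancel, so [l G <= k G_a] makes
    the sum of the [G] non-positive. Each [G] is non-negative, hence zero, in particular at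
    [z = 1]. *)
Lemma leading_cosine_eq0 (a : 'I_k) :
    (forall v, v \in mu L -> schatten v -> a \notin supp v) ->
  leading L (cosine 1) = 0.
Proof.
move=> nS.
have [p kp p_pr] := prime_above k.
have [w wp] := prime_primitive_root_exists R[i] p_pr.
have w1 : `|w| = 1.
  apply/eqP; rewrite -(@pexpr_eq1 _ _ p) ?prime_gt0 // -normrX.
  by rewrite (prim_expr_order wp) normr1.
have l0 : 0 < (girth L)%:R :> R by rewrite ltr0n (girth_gt0 v0_mu).
pose G i := leading L (cosine (w ^+ i)).
have G0 i : 0 <= G i.
  exact: (leading_ge0 eD e_norm e_neq1 normL v0_mu (cosine_spectrum _) (cosine_coef0 _)).
have sumG : \sum_(i < p) G i <= 0.
  rewrite -(pmulr_rle0 _ l0) mulr_sumr.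
  apply: le_trans (_ : \sum_(i < p) k%:R * leading_at L (cosine (w ^+ i)) a <= 0).
    apply: ler_sum => i _.
    exact: (leading_le_at eD e_norm e_neq1 normL v0_mu _
      (cosine_spectrum _) (cosine_coef0 _)).
  rewrite -mulr_sumr le_eqVlt; apply/orP; left; rewrite mulf_eq0; apply/orP; right.
  rewrite -(fmorph_eq0 (real_complex R)) rmorph_sum /=; apply/eqP.
  under eq_bigr do rewrite rmorph_sum /=.
  rewrite exchange_big big1 //= => S /andP[/eqP Sl aS].
  under eq_bigr do rewrite (partial_mlin_spectrum L eD e_norm e_neq1 S
    (cosine_spectrum _) (cosine_coef0 _)).
  rewrite exchange_big big1 //= => v /andP[vL /eqP sv].
  rewrite -sv; apply: (sum_prod_cosine_coef kp wp w1).
  apply: contraTN aS => schv; rewrite -sv; apply: nS schv.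
  rewrite inE vL sv Sl eqxx -supp_eq0 sv -cards_eq0 Sl -lt0n.
  by rewrite (girth_gt0 v0_mu).
have /psumr_eq0P H : \sum_(i < p) G i = 0.
  by apply/eqP; rewrite eq_le sumG sumr_ge0.
by have := H (fun i _ => G0 i) (Ordinal (prime_gt0 p_pr)) isT; rewrite /G expr0.
Qed.

(** * Averaging over dilations *)

Lemma t_dilate (f : 'rV[F]_1 -> R) (l : F) :
  l != 0 -> t L (fun x => f (l *: x)) = t L f.
Proof.
move=> l0; congr (_ * _).
rewrite [RHS](reindex (fun x : {ffun 'I_k -> 'rV[F]_1} => [ffun j => l *: x j])) /=.
  apply: eq_big => x; last by move=> _; apply: eq_bigr => j _; rewrite ffunE.
  rewrite !sol1E.
  have -> : \col_j [ffun j => l *: x j] j 0 0 = l *: \col_j x j 0 0.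
    by apply/colP => j; rewrite !mxE ffunE mxE.
  by rewrite -scalemxAr scaler_eq0 (negPf l0).
exists (fun x : {ffun 'I_k -> 'rV[F]_1} => [ffun j => l^-1 *: x j]) => x _;
  by apply/ffunP => j; rewrite !ffunE scalerA ?mulVf ?mulfV ?scale1r.
Qed.

Definition mean_cosine (x : 'rV[F]_1) : R :=
  (#|predC1 (0 : F)|%:R)^-1 * \sum_(l in predC1 0) cosine 1 (l *: x).

(** The dilations carry [e] and its conjugate through all non-trivial characters once each, whence
    the factor [2]. *)
Definition mean_cosine_coef (l : F) : R[i] :=
  2 / #|predC1 (0 : F)|%:R * (l != 0)%:R.

Lemma mean_cosine_spectrum : has_spectrum e mean_cosine mean_cosine_coef.
Proof.
move=> x; rewrite /mean_cosine rmorphM fmorphV rmorph_nat rmorph_sum /=.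
under [RHS]eq_bigr do rewrite /mean_cosine_coef (mulrC 2) -!mulrA.
rewrite -mulr_sumr; congr (_ * _); rewrite -mulr_sumr.
under eq_bigr do rewrite cosineE conjc1 !mul1r mxE.
rewrite big_split /= mulr_natl mulr2n.
have E : \sum_(l in predC1 0) e (l * x 0 0) = \sum_l (l != 0)%:R * e (l * x 0 0).
  rewrite big_mkcond; apply: eq_bigr => l _; rewrite inE /=.
  by case: ifP; rewrite ?mul1r ?mul0r.
rewrite E; congr (_ + _); rewrite -E (reindex_inj oppr_inj).
by apply: eq_big => l; rewrite ?inE /= ?oppr_eq0 // mulNr opprK.
Qed.

(** Every vector of [mu L] contributes a positive product of coefficients, and [v0] is one of
    them. *)
Lemma leading_mean_cosine_gt0 : 0 < leading L mean_cosine.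
Proof.
have q0 : (0 < #|predC1 (0%R : F)|)%N.
  by apply/card_gt0P; exists 1; rewrite inE oner_eq0.
have coef0 : mean_cosine_coef 0 = 0 by rewrite /mean_cosine_coef eqxx mulr0.
have coef_gt0 l : l != 0 -> 0 < mean_cosine_coef l.
  by move=> l0; rewrite /mean_cosine_coef l0 mulr1 divr_gt0 ?ltr0n.
have prod_gt0 (v : 'rV[F]_k) : 0 < \prod_(j in supp v) mean_cosine_coef (v 0 j).
  by apply: prodr_gt0 => j; rewrite inE; apply: coef_gt0.
rewrite -ltcR rmorph_sum /=.
under eq_bigr do rewrite (partial_mlin_spectrum L eD e_norm e_neq1 _
  mean_cosine_spectrum coef0).
have := v0_mu; rewrite inE => /and3P[v0L _ sv0].
rewrite (bigD1 (supp v0)) //= (bigD1 v0) /= ?v0L ?eqxx //.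
rewrite -addrA ltr_wpDr ?prod_gt0 ?addr_ge0 ?sumr_ge0 // => [v|S _].
  by move=> /andP[/andP[_ /eqP <-] _]; exact: ltW (prod_gt0 v).
by apply: sumr_ge0 => v /andP[_ /eqP <-]; exact: ltW (prod_gt0 v).
Qed.

(* [1 + c * mean_cosine] is an average of dilates of [1 + c * cosine 1], on
   which [t] takes a single value. *)
Lemma leading_mean_cosine_le : leading L mean_cosine <= leading L (cosine 1).
Proof.
pose Q := predC1 (0 : F).
have q0 : 0 < #|Q|%:R :> R.
  by rewrite ltr0n; apply/card_gt0P; exists 1; rewrite inE oner_eq0.
have coef0 : mean_cosine_coef 0 = 0 by rewrite /mean_cosine_coef eqxx mulr0.
have [r r0 Hr] := perturb_gt0 (cosine 1).
rewrite -subr_ge0 -!coef_one_poly_girth -coefB.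
apply: (coef_ge0_of_horner_ge0 r0) => [i il|c cr].
  rewrite coefB (coef_one_poly eD e_norm e_neq1 mean_cosine_spectrum coef0 il).
  rewrite (coef_one_poly eD e_norm e_neq1 (cosine_spectrum 1) (cosine_coef0 1) il).
  by rewrite subrr.
rewrite hornerD hornerN subr_ge0 !horner_mlin_poly.
(* The value at [l = 0] is a placeholder, as [0] lies outside [Q]. *)
pose f (l : F) (x : 'rV[F]_1) := if l == 0 then 1 else 1 + c * cosine 1 (l *: x).
pose M := t L (fun x => 1 + c * cosine 1 x).
have M0 : 0 <= M by rewrite /M t_mlin mlin_ge0 // => j x; apply/ltW/Hr.
have f0 l x : 0 <= f l x by rewrite /f; case: ifP => // _; apply/ltW/Hr.
have := t_sum_le (mu_dim_gt0 v0_mu) normL (A := Q) (ltn0Sn 0) M0 f0.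
move=> /(_ _)/wrap[l|].
  rewrite inE => l0; rewrite /M -(t_dilate (fun x => 1 + c * cosine 1 x) l0) !t_mlin.
  rewrite le_eqVlt; apply/orP; left; apply/eqP.
  by apply: eq_mlin => j x; rewrite /f (negPf l0).
have -> : t L (fun x => \sum_(l in Q) f l x)
    = #|Q|%:R ^+ k * mlin L (fun _ x => 1 + c * mean_cosine x).
  rewrite -mlinZc t_mlin; apply: eq_mlin => j x.
  rewrite (eq_bigr (fun l => 1 + c * cosine 1 (l *: x))) => [|l]; last first.
    by rewrite inE /f => /negPf ->.
  rewrite big_split /= sumr_const -mulr_sumr mulrDr mulr1 /mean_cosine mulrCA.
  by congr (_ + _ * _); rewrite mulrA mulfV ?mul1r // gt_eqF.
by rewrite ler_pM2l ?exprn_gt0.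
Qed.

End Cosines.

(** * Counting normalised Schatten vectors *)

Section Main.
Variables (R : realType) (F : finFieldType) (m k : nat) (L : 'M[F]_(m, k)).
Hypotheses (normL : @weakly_norming R F m k L) (v0 : 'rV[F]_k)
  (v0_mu : v0 \in mu L).

(** Otherwise [leading L (cosine 1)] would vanish, although it bounds the positive
    [leading L mean_cosine] from above. *)
Lemma schatten_cover (a : 'I_k) :
  exists v, [/\ v \in mu L, schatten v & a \in supp v].
Proof.
have [/existsP[v /and3P[]]|nS] :=
    boolP [exists v, [&& v \in mu L, schatten v & a \in supp v]].
  by exists v.
have [e [eD e_norm e_neq1]] := additive_character_exists R[i] F.
have := leading_mean_cosine_gt0 eD e_norm e_neq1 v0_mu.
have := leading_mean_cosine_le eD e_norm e_neq1 normL v0_mu.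
rewrite (leading_cosine_eq0 eD e_norm e_neq1 normL v0_mu (a := a)) => [h1 h2|v v_mu vS].
  by have := lt_le_trans h2 h1; rewrite ltxx.
apply: contra nS => av; apply/existsP; exists v; exact/and3P.
Qed.

Lemma supp_scale (c : F) (v : 'rV[F]_k) : c != 0 -> supp (c *: v) = supp v.
Proof.
by move=> c0; apply/setP => j; rewrite !inE mxE mulf_eq0 (negPf c0).
Qed.

Lemma mu_scale (c : F) (v : 'rV[F]_k) : c != 0 -> v \in mu L -> c *: v \in mu L.
Proof.
move=> c0; rewrite !inE supp_scale // scaler_eq0 (negPf c0) /= => /and3P[vL -> ->].
by rewrite scalemx_sub.
Qed.

Lemma schatten_scale (c : F) (v : 'rV[F]_k) :
  c != 0 -> schatten v -> schatten (c *: v).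
Proof.
move=> c0 /existsP[b /andP[/forallP vb /eqP card_b]].
apply/existsP; exists (c * b); apply/andP; split.
  apply/forallP => j; have := vb j; rewrite mxE !inE.
  by case/or3P => /eqP ->; rewrite ?mulr0 ?mulrN ?eqxx ?orbT.
have E (d : F) : [set j | (c *: v) 0 j == c * d] = [set j | v 0 j == d].
  by apply/setP => j; rewrite !inE mxE (inj_eq (mulfI c0)).
by rewrite -mulrN !E card_b.
Qed.

Lemma normalised_scale (v : 'rV[F]_k) :
  v != 0 -> exists2 c : F, c != 0 & normalised (c *: v).
Proof.
rewrite -supp_eq0 => /set0Pn[j]; rewrite inE => vj.
have [i vi imin] := @arg_minnP _ j (fun i => v 0 i != 0) val vj.
exists (v 0 i)^-1; first by rewrite invr_eq0.
apply/existsP; exists i; rewrite mxE mulVf // eqxx; apply/forallP => l.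
apply/implyP => li; rewrite mxE mulf_eq0 invr_eq0 (negPf vi) /=.
by apply: contraLR li => vl; rewrite -leqNgt imin.
Qed.

(** Double counting: each counted vector covers [girth L] coordinates, and every coordinate is
    covered because normalising a Schatten vector keeps its support. *)
Lemma dim_le_s_girth : (k <= s L * girth L)%N.
Proof.
pose A := [set v in mu L | schatten v && normalised v].
have -> : (s L * girth L = \sum_(v in A) #|supp v|)%N.
  rewrite (eq_bigr (fun=> girth L)) ?sum_nat_const // => v.
  by rewrite !inE => /andP[/and3P[_ _ /eqP]].
rewrite (eq_bigr (fun v => \sum_(j < k) (j \in supp v))%N) => [|v _]; last first.
  by rewrite -sum1_card big_mkcond.
rewrite exchange_big -[X in (X <= _)%N]card_ord -sum1_card leq_sum //= => j _.
have [v [v_mu vS jv]] := schatten_cover j.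
have v_neq0 : v != 0 by move: v_mu; rewrite inE => /and3P[].
have [c c0 nv] := normalised_scale v_neq0.
rewrite (bigD1 (c *: v)) /=; first by rewrite supp_scale // jv.
by rewrite inE mu_scale // schatten_scale.
Qed.

End Main.

Theorem theorem5p1 (R : realType) (F : finFieldType) (m k : nat)
    (L : 'M[F]_(m, k)) (hL : row_free L) (hW : @weakly_norming R F m k L) :
  (forall v : 'rV[F]_k, v \in mu L -> schatten v) \/
  (k%:R / (girth L)%:R <= (s L)%:R :> R).
Proof.
(* If [mu L] is empty the first alternative is vacuous; in all other cases the second one holds. *)
have [mu0|[v v_mu]] := set_0Vmem (mu L).
  by left=> v; rewrite mu0 inE.
right; rewrite ler_pdivrMr ?ltr0n ?(girth_gt0 v_mu) // -natrM ler_nat.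
exact: (dim_le_s_girth hW v_mu).
Qed.
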